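(* Let $K$ be a field of characteristic two. The $\mathbb{Z}$-graded identities of the Lie algebra $U_1$ over $K$ do not admit any finite basis, and the $\mathbb{Z}$-graded identities of the Lie algebra $W_1$ over $K$ do not admit any finite basis. That is, neither $T_{\mathbb{Z}}(U_1)$ nor $T_{\mathbb{Z}}(W_1)$ is generated, as a $T_{\mathbb{Z}}$-ideal, by a finite set of polynomials.
   Context: $K$ is an arbitrary field of characteristic two (possibly finite). $U_1=\mathrm{Der}(K[t,t^{-1}])$ has basis $e_n=t^{n+1}\,d/dt$, $n\in\mathbb{Z}$, with $[e_i,e_j]=(j-i)e_{i+j}$, and is $\mathbb{Z}$-graded with $i$-th component $Ke_i$ for all $i\in\mathbb{Z}$. $W_1=\mathrm{Der}(K[t])$ has basis $e_n=t^{n+1}\,d/dt$, $n\ge -1$, with the same multiplication rule, and is $\mathbb{Z}$-graded with $i$-th component $Ke_i$ for $i\ge -1$ and $0$ for $i\le -2$. Let $X=\bigcup_{i\in\mathbb{Z}}X_i$ be a disjoint union of countably infinite sets of variables $X_i=\{x_1^i,x_2^i,\ldots\}$, where the variables in $X_i$ have $\mathbb{Z}$-degree $i$ (the superscript is a degree, not a power). $L\langle X_{\mathbb{Z}}\rangle$ is the free Lie algebra over $K$ freely generated by $X$ (the Lie subalgebra generated by $X$ of the free associative algebra with bracket $[u,v]=uv-vu$), with the induced $\mathbb{Z}$-grading. Its elements are called polynomials. For a $\mathbb{Z}$-graded Lie algebra $L=\bigoplus_i L_i$, a polynomial $f(x_1^{a_1},\ldots,x_n^{a_n})\in L\langle X_{\mathbb{Z}}\rangle$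 is a graded identity of $L$ if $f(l_1,\ldots,l_n)=0$ for all $l_i\in L_{a_i}$, $i=1,\ldots,n$. The set of all graded identities of $L$ is denoted $T_{\mathbb{Z}}(L)$. A $T_{\mathbb{Z}}$-ideal is an ideal of $L\langle X_{\mathbb{Z}}\rangle$ invariant under all graded (degree-preserving) endomorphisms of $L\langle X_{\mathbb{Z}}\rangle$. The $T_{\mathbb{Z}}$-ideal generated by a set $S$ is the intersection of all $T_{\mathbb{Z}}$-ideals containing $S$; $S$ is then called a basis of it. *)

(* Defs.v *)
From HB Require Import structures.
From mathcomp Require Import all_boot all_order all_algebra finmap.
From mathcomp Require Import boolp classical_sets functions cardinality.
From mathcomp Require Import zify.
From mathcomp Require Import monalg.

Set Implicit Arguments.
Unset Strict Implicit.
Unset Printing Implicit Defensive.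

Import Order.TTheory GRing.Theory Num.Theory.

Local Open Scope ring_scope.
Local Open Scope classical_set_scope.

HB.mixin Record Lmodule_isLieAlgebra (K : fieldType) L of GRing.Lmodule K L := {
  lbr : L -> L -> L;
  lbr_linearl : forall y, linear (lbr ^~ y);
  lbr_linearr : forall x, linear (lbr x);
  lbrxx : forall x, lbr x x = 0;
  lbr_jacobi : forall x y z,
    lbr x (lbr y z) + lbr y (lbr z x) + lbr z (lbr x y) = 0
}.

#[short(type="lieAlgType")]
HB.structure Definition LieAlgebra (K : fieldType) :=
  { L of GRing.Lmodule K L & Lmodule_isLieAlgebra K L }.

Definition subspace_set (K : fieldType) (V : lmodType K) (S : set V) : Prop :=
  S 0 /\ forall (c : K) (u v : V), S u -> S v -> S (c *: u + v).

Definition lie_ideal (K : fieldType) (L : lieAlgType K) (I : set L) : Prop :=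
  subspace_set I /\ forall u v : L, I v -> I (lbr u v).

Definition lie_hom (K : fieldType) (L M : lieAlgType K) (phi : L -> M) : Prop :=
  linear phi /\ {morph phi : u v / lbr u v}.

Definition commutator (R : pzRingType) (u v : R) : R := u * v - v * u.

Lemma commutator_jacobi (R : pzRingType) (u v w : R) :
  commutator u (commutator v w) + commutator v (commutator w u)
  + commutator w (commutator u v) = 0.
Proof.
rewrite /commutator !(mulrBl, mulrBr) !mulrA !opprB !addrA.
rewrite [LHS](ACl ((1*12)*(2*7)*(3*10)*(4*5)*(6*11)*(8*9)))/=.
by rewrite !(subrr, addNr) !addr0.
Qed.

(* [(a, j)] is the variable of degree [a] and index [j + 1]. *)
Definition var : choiceType := (int * nat)%type.

Definition var_deg (x : var) : int := x.1.

Notation free_assoc K := {malg K[{fmonom var}]}.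

Definition letter (K : fieldType) (x : var) : free_assoc K := << fmu x >>.

Definition lie_subalg_closed (K : fieldType) (S : set (free_assoc K)) : Prop :=
  subspace_set S /\ forall u v, S u -> S v -> S (commutator u v).

Definition free_lie_set (K : fieldType) : set (free_assoc K) :=
  smallest (@lie_subalg_closed K) (range (@letter K)).

Definition free_lie_pred (K : fieldType) : {pred free_assoc K} :=
  fun f => `[< free_lie_set f >].

Lemma free_lie_closed (K : fieldType) : lie_subalg_closed (@free_lie_set K).
Proof.
split; first split.
- by move=> S [[[S0 _] _] _].
- move=> c u v Su Sv S /= SP; have [[[_ SZ] _] _] := SP.
  by apply: SZ; [exact: Su | exact: Sv].
- move=> u v Su Sv S /= SP; have [[_ Sbr] _] := SP.
  by apply: Sbr; [exact: Su | exact: Sv].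
Qed.

Lemma free_lie_submod_closed (K : fieldType) : submod_closed (@free_lie_pred K).
Proof.
have [[S0 SZ] _] := free_lie_closed K.
split; first exact/asboolP.
by move=> c u v /asboolP Su /asboolP Sv; apply/asboolP; exact: SZ.
Qed.

HB.instance Definition _ (K : fieldType) :=
  GRing.isSubmodClosed.Build K (free_assoc K) (@free_lie_pred K)
    (@free_lie_submod_closed K).

Record free_lie (K : fieldType) : predArgType := FreeLie {
  free_lie_val : free_assoc K;
  free_lie_valP : free_lie_val \in @free_lie_pred K
}.

HB.instance Definition _ (K : fieldType) := [isSub for @free_lie_val K].
HB.instance Definition _ (K : fieldType) := [Choice of free_lie K by <:].
HB.instance Definition _ (K : fieldType) :=
  [SubChoice_isSubLmodule of free_lie K by <:].

Lemma malg_scaleU (K : fieldType) (T : choiceType) (c c' : K) (k : T) :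
  c *: << c' *g k >> = << c * c' *g k >> :> {malg K[T]}.
Proof. by apply/malgP => k'; rewrite mcoeffZ !mcoeffU mulrnAr. Qed.

Lemma free_assoc_scaleAr (K : fieldType) (c : K) (f g : free_assoc K) :
  c *: (f * g) = f * (c *: g).
Proof.
rewrite !malgM_def [in RHS](fgmullw (fsubset_refl _) (msuppZ_le c g)).
rewrite fgmull scaler_sumr; apply: eq_bigr => i _.
rewrite scaler_sumr; apply: eq_bigr => j _.
by rewrite malg_scaleU mcoeffZ mulrCA.
Qed.

Section FreeLieBracket.
Variable K : fieldType.

Lemma free_lie_bracket_subproof (f g : free_lie K) :
  commutator (val f) (val g) \in @free_lie_pred K.
Proof.
have [_ Sbr] := free_lie_closed K; apply/asboolP; apply: Sbr.
- exact/asboolP/free_lie_valP.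
- exact/asboolP/free_lie_valP.
Qed.

Definition free_lie_bracket (f g : free_lie K) : free_lie K :=
  FreeLie (free_lie_bracket_subproof f g).

Lemma free_lie_bracket_linearl g : linear (free_lie_bracket ^~ g).
Proof.
move=> c u v; apply: val_inj; rewrite [RHS]linearP /= /commutator.
rewrite mulrDl mulrDr scalerBr -scalerAl -free_assoc_scaleAr.
by rewrite opprD addrACA.
Qed.

Lemma free_lie_bracket_linearr f : linear (free_lie_bracket f).
Proof.
move=> c u v; apply: val_inj; rewrite [RHS]linearP /= /commutator.
rewrite mulrDl mulrDr scalerBr -scalerAl -free_assoc_scaleAr.
by rewrite opprD addrACA.
Qed.

Lemma free_lie_bracketxx f : free_lie_bracket f f = 0.
Proof. by apply: val_inj; rewrite /= /commutator subrr. Qed.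

Lemma free_lie_bracket_jacobi f g h :
  free_lie_bracket f (free_lie_bracket g h)
  + free_lie_bracket g (free_lie_bracket h f)
  + free_lie_bracket h (free_lie_bracket f g) = 0.
Proof. by apply: val_inj; rewrite raddf0 !raddfD /= commutator_jacobi. Qed.

HB.instance Definition _ := Lmodule_isLieAlgebra.Build K (free_lie K)
  free_lie_bracket_linearl free_lie_bracket_linearr free_lie_bracketxx
  free_lie_bracket_jacobi.

End FreeLieBracket.

Lemma free_lie_gen_subproof (K : fieldType) (x : var) :
  letter K x \in @free_lie_pred K.
Proof. by apply/asboolP; apply: sub_gen_smallest; exists x. Qed.

Definition free_lie_gen (K : fieldType) (x : var) : free_lie K :=
  FreeLie (free_lie_gen_subproof K x).

Definition word_deg (w : {fmonom var}) : int := \sum_(x <- w) var_deg x.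

Definition free_lie_comp (K : fieldType) (i : int) : set (free_lie K) :=
  [set f | forall w, w \in msupp (val f) -> word_deg w = i].


Section Derivations.
Variables (K : fieldType) (A : comAlgType K).

Definition is_derivation (D : A -> A) : Prop :=
  linear D /\ forall a b, D (a * b) = a * D b + D a * b.

Definition der_pred : {pred A -> A} := fun D => `[< is_derivation D >].

Lemma fct_linE (c : K) (D E : A -> A) a : (c *: D + E) a = c *: D a + E a.
Proof. by []. Qed.

Lemma der_submod_closed : submod_closed der_pred.
Proof.
split.
  have E0 x : (0 : A -> A) x = 0 by [].
  apply/asboolP; split=> [c u v|a b]; rewrite !E0.
    by rewrite scaler0 addr0.
  by rewrite mulr0 mul0r addr0.
move=> c D E /asboolP[lD dD] /asboolP[lE dE]; apply/asboolP; split.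
  move=> k u v; rewrite !fct_linE lD lE !scalerDr !scalerA (mulrC c k).
  by rewrite addrACA.
move=> a b; rewrite !fct_linE dD dE !scalerDr mulrDr mulrDl.
by rewrite -scalerAr -scalerAl addrACA.
Qed.

HB.instance Definition _ :=
  GRing.isSubmodClosed.Build K (A -> A) der_pred der_submod_closed.

Record Der : predArgType := MkDer {
  der_fun :> A -> A;
  der_funP : der_fun \in der_pred
}.

HB.instance Definition _ := [isSub for der_fun].
HB.instance Definition _ := [Choice of Der by <:].
HB.instance Definition _ := [SubChoice_isSubLmodule of Der by <:].

Lemma derP (D : Der) : is_derivation D.
Proof. exact/asboolP/der_funP. Qed.

Lemma der_linear (D : Der) : linear D.
Proof. by case: (derP D). Qed.

Lemma derM (D : Der) a b : D (a * b) = a * D b + D a * b.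
Proof. by case: (derP D). Qed.

Lemma derD (D : Der) a b : D (a + b) = D a + D b.
Proof. by rewrite -[a]scale1r der_linear !scale1r. Qed.

Lemma derZ (D : Der) c a : D (c *: a) = c *: D a.
Proof.
have D0 : D 0 = 0 by apply: (addrI (D 0)); rewrite -derD !addr0.
by rewrite -[c *: a]addr0 der_linear D0 addr0.
Qed.

Lemma derB (D : Der) a b : D (a - b) = D a - D b.
Proof. by rewrite -scaleN1r derD derZ scaleN1r. Qed.

Lemma der_bracket_subproof (D E : Der) :
  (fun a => D (E a) - E (D a)) \in der_pred.
Proof.
apply/asboolP; split=> [c u v|a b].
  by rewrite !der_linear opprD addrACA scalerBr.
rewrite !derM !derD !derM mulrBr mulrBl !opprD !addrA.
rewrite [LHS](ACl ((1*5)*(4*8)*(2*7)*(3*6)))/=.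
by rewrite !subrr !addr0 addrA.
Qed.

Definition der_bracket (D E : Der) : Der := MkDer (der_bracket_subproof D E).

Lemma der_bracket_linearl E : linear (der_bracket ^~ E).
Proof.
move=> c D D'; apply: val_inj; apply/funext => a.
rewrite [in RHS]linearP /= !fct_linE derD derZ.
by rewrite opprD addrACA scalerBr.
Qed.

Lemma der_bracket_linearr D : linear (der_bracket D).
Proof.
move=> c E E'; apply: val_inj; apply/funext => a.
rewrite [in RHS]linearP /= !fct_linE derD derZ.
by rewrite opprD addrACA scalerBr.
Qed.

Lemma der_bracketxx D : der_bracket D D = 0.
Proof. by apply: val_inj; apply/funext => a; rewrite raddf0 /= subrr. Qed.

Lemma der_bracket_jacobi D E F :
  der_bracket D (der_bracket E F) + der_bracket E (der_bracket F D)
  + der_bracket F (der_bracket D E) = 0.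
Proof.
apply: val_inj; apply/funext => a; rewrite raddf0 !raddfD /= !fctE /=.
rewrite !derB !opprB !addrA.
rewrite [LHS](ACl ((1*12)*(2*7)*(3*10)*(4*5)*(6*11)*(8*9)))/=.
by rewrite !(subrr, addNr) !addr0.
Qed.

HB.instance Definition _ := Lmodule_isLieAlgebra.Build K Der
  der_bracket_linearl der_bracket_linearr der_bracketxx der_bracket_jacobi.

Lemma lbrDerE (D E : Der) a : lbr D E a = D (E a) - E (D a).
Proof. by []. Qed.

Lemma mul_der_subproof (a : A) (D : Der) : (fun b => a * D b) \in der_pred.
Proof.
apply/asboolP; split=> [c u v|b b'].
  by rewrite der_linear mulrDr -scalerAr.
by rewrite derM mulrDr !mulrA (mulrC a b).
Qed.

Definition mul_der (a : A) (D : Der) : Der := MkDer (mul_der_subproof a D).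

End Derivations.

Section W1.
Variable K : fieldType.

Lemma deriv_subproof : (@deriv K : {poly K} -> {poly K}) \in @der_pred K {poly K}.
Proof.
apply/asboolP; split=> [c u v|a b]; first by rewrite derivD derivZ.
by rewrite derivM addrC.
Qed.

Definition poly_ddt : Der {poly K} := MkDer deriv_subproof.

Definition W1 : lieAlgType K := Der {poly K}.

(* $e_i = t^{i+1} d/dt$, meaningful only for $i \ge -1$. *)
Definition W1_e (i : int) : W1 := mul_der 'X^(absz (i + 1)) poly_ddt.

Definition W1_comp (i : int) : set W1 :=
  if -1 <= i then range (fun c : K => c *: W1_e i) else [set 0].

End W1.

(* $<< c *g i >>$ is the monomial $c t^i$. *)
Definition laurent (K : fieldType) := {malg K[int]}.

HB.instance Definition _ (K : fieldType) := GRing.Lmodule.on (laurent K).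

HB.lock Definition laurent_mul (K : fieldType) (f g : laurent K) : laurent K :=
  \sum_(i <- msupp f) \sum_(j <- msupp g) << f@_i * g@_j *g i + j >>.

HB.lock Definition laurent_deriv (K : fieldType) (f : laurent K) : laurent K :=
  \sum_(i <- msupp f) << f@_i *~ i *g i - 1 >>.

Section Laurent.
Variable K : fieldType.

Local Notation laurent := (laurent K).
Local Notation laurent_mul := (@laurent_mul K).
Local Notation laurent_deriv := (@laurent_deriv K).

Implicit Types f g h : laurent.

Lemma laurent_mulw (d1 d2 : {fset int}) f g :
  (msupp f `<=` d1)%fset -> (msupp g `<=` d2)%fset ->
  laurent_mul f g = \sum_(i <- d1) \sum_(j <- d2) << f@_i * g@_j *g i + j >>.
Proof.
move=> le1 le2; rewrite laurent_mul.unlock (big_fset_incl _ le1) /=; last first.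
  move=> i _ /mcoeff_outdom fi; rewrite big1 // => j _.
  by rewrite fi mul0r monalgU0.
apply: eq_bigr => i _; apply: big_fset_incl => // j _ /mcoeff_outdom gj.
by rewrite gj mulr0 monalgU0.
Qed.

Lemma laurent_mulC : commutative laurent_mul.
Proof.
move=> f g; rewrite laurent_mul.unlock exchange_big /=.
by do 2![apply: eq_bigr => ? _]; rewrite mulrC addrC.
Qed.

Lemma laurent_mulDl : left_distributive laurent_mul +%R.
Proof.
move=> f g h; rewrite (laurent_mulw (msuppD_le f g) (fsubset_refl _)).
rewrite (laurent_mulw (fsubsetUl _ (msupp g)) (fsubset_refl (msupp h))).
rewrite (laurent_mulw (fsubsetUr (msupp f) _) (fsubset_refl (msupp h))).
rewrite -big_split; apply: eq_bigr => i _.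
rewrite -big_split; apply: eq_bigr => j _.
by rewrite /= mcoeffD mulrDl monalgUD.
Qed.

Lemma laurent_mulDr : right_distributive laurent_mul +%R.
Proof. by move=> f g h; rewrite !(laurent_mulC f) laurent_mulDl. Qed.

Lemma laurent_mul0l : left_zero 0 laurent_mul.
Proof. by move=> f; rewrite laurent_mul.unlock msupp0 big_seq_fset0. Qed.

Lemma laurent_mul0r : right_zero 0 laurent_mul.
Proof. by move=> f; rewrite laurent_mulC laurent_mul0l. Qed.

Lemma laurent_mulUU (c c' : K) (i j : int) :
  laurent_mul << c *g i >> << c' *g j >> = << c * c' *g i + j >>.
Proof.
rewrite (laurent_mulw msuppU_le msuppU_le) !big_seq_fset1.
by rewrite !mcoeffUU.
Qed.

Lemma laurent_ind (P : laurent -> Prop) :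
  P 0 -> (forall f g, P f -> P g -> P (f + g)) ->
  (forall (c : K) (i : int), P << c *g i >>) -> forall f, P f.
Proof.
move=> P0 PD PU f; rewrite [f]monalgE.
by elim/big_ind: _ => // i _; exact: PU.
Qed.

Lemma laurent_mulA : associative laurent_mul.
Proof.
move=> f g h; elim/laurent_ind: f => [|f f' IH IH'|c i].
- by rewrite !laurent_mul0l.
- by rewrite !laurent_mulDl IH IH'.
elim/laurent_ind: g => [|g g' IH IH'|c' j].
- by rewrite laurent_mul0l !laurent_mul0r laurent_mul0l.
- by rewrite laurent_mulDl !laurent_mulDr laurent_mulDl IH IH'.
elim/laurent_ind: h => [|h h' IH IH'|c'' k].
- by rewrite !laurent_mul0r.
- by rewrite !laurent_mulDr IH IH'.
by rewrite !laurent_mulUU mulrA addrA.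
Qed.

Definition laurent_one : laurent := << 0%R >>.

Lemma laurent_mul1l : left_id laurent_one laurent_mul.
Proof.
move=> f; elim/laurent_ind: f => [|f f' IH IH'|c i].
- exact: laurent_mul0r.
- by rewrite laurent_mulDr IH IH'.
by rewrite laurent_mulUU mul1r add0r.
Qed.

Lemma laurent_one_neq0 : laurent_one != 0.
Proof. by rewrite monalgU_eq0 oner_eq0. Qed.

HB.instance Definition _ := GRing.Zmodule_isComNzRing.Build laurent
  laurent_mulA laurent_mulC laurent_mul1l laurent_mulDl laurent_one_neq0.

Lemma laurentM_UU (c c' : K) (i j : int) :
  (<< c *g i >> : laurent) * (<< c' *g j >> : laurent)
  = << c * c' *g i + j >>.
Proof. exact: laurent_mulUU. Qed.

Lemma laurent_scaleU (c c' : K) (i : int) :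
  c *: << c' *g i >> = << c * c' *g i >> :> laurent.
Proof. exact: malg_scaleU. Qed.

Lemma laurent_scaleAl (c : K) f g : c *: (f * g) = c *: f * g.
Proof.
elim/laurent_ind: f => [|f f' IH IH'|c' i].
- by rewrite mul0r !scaler0 mul0r.
- by rewrite mulrDl !scalerDr mulrDl IH IH'.
elim/laurent_ind: g => [|g g' IH IH'|c'' j].
- by rewrite !mulr0 scaler0.
- by rewrite !mulrDr scalerDr IH IH'.
by rewrite !(laurentM_UU, laurent_scaleU) mulrA.
Qed.

HB.instance Definition _ :=
  GRing.Lmodule_isLalgebra.Build K laurent laurent_scaleAl.
HB.instance Definition _ := GRing.Lalgebra_isComAlgebra.Build K laurent.

Lemma laurent_derivE f (k : int) : (laurent_deriv f)@_k = f@_(k + 1) *~ (k + 1).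
Proof.
rewrite laurent_deriv.unlock raddf_sum /=.
under eq_bigr => i _ do rewrite mcoeffU subr_eq.
have [kf|kf] := boolP (k + 1 \in msupp f).
  rewrite (big_fsetD1 (k + 1)) //= eqxx big1_fset ?addr0 // => i.
  by rewrite in_fsetD1 => /andP[/negPf-> _] _.
rewrite mcoeff_outdom // mul0rz big1_fset // => i fi _.
by case: eqP fi kf => // -> ->.
Qed.

Lemma laurent_derivU (c : K) (i : int) :
  laurent_deriv << c *g i >> = << c *~ i *g i - 1 >>.
Proof.
apply/malgP => k; rewrite laurent_derivE !mcoeffU subr_eq.
by case: eqP => [->|]; rewrite ?mulr1n // mulr0n mul0rz.
Qed.

Lemma laurent_deriv_linear : linear laurent_deriv.
Proof.
move=> c f g; apply/malgP => k.
rewrite mcoeffD mcoeffZ !laurent_derivE mcoeffD mcoeffZ.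
by rewrite mulrzDl mulrzAr.
Qed.

Lemma laurent_deriv_subproof : laurent_deriv \in @der_pred K laurent.
Proof.
have d0 : laurent_deriv 0 = 0.
  by apply/malgP => k; rewrite laurent_derivE !mcoeff0 mul0rz.
have dD f g : laurent_deriv (f + g) = laurent_deriv f + laurent_deriv g.
  by rewrite -[f]scale1r laurent_deriv_linear !scale1r.
apply/asboolP; split=> [|f g]; first exact: laurent_deriv_linear.
elim/laurent_ind: f => [|f f' IH IH'|c i].
- by rewrite d0 !mul0r d0 addr0.
- by rewrite dD !mulrDl dD IH IH' addrACA.
elim/laurent_ind: g => [|g g' IH IH'|c' j].
- by rewrite d0 !mulr0 d0 addr0.
- by rewrite dD !mulrDr dD IH IH' addrACA.
rewrite !(laurentM_UU, laurent_derivU) (addrA i) (addrAC i (- 1)).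
by rewrite -monalgUD mulrzAr mulrzAl -mulrzDr (addrC j).
Qed.

Definition laurent_ddt : Der laurent := MkDer laurent_deriv_subproof.

Definition U1 : lieAlgType K := Der laurent.

(* $e_i = t^{i+1} d/dt$. *)
Definition U1_e (i : int) : U1 := mul_der (<< i + 1 >> : laurent) laurent_ddt.

Definition U1_comp (i : int) : set U1 := range (fun c : K => c *: U1_e i).

End Laurent.

Lemma der_scaleE (K : fieldType) (A : comAlgType K) (c : K) (D : Der A) a :
  (c *: D) a = c *: D a.
Proof. by []. Qed.

Lemma der_sumE (K : fieldType) (A : comAlgType K) (I : Type) (r : seq I)
    (c : I -> K) (D : I -> Der A) a :
  (\sum_(i <- r) c i *: D i) a = \sum_(i <- r) c i *: D i a.
Proof. by elim: r => [|i r IH]; rewrite ?big_nil // !big_cons -IH. Qed.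

Lemma der_eqP (K : fieldType) (A : comAlgType K) (D E : Der A) :
  D =1 E -> D = E.
Proof. by move=> DE; apply: val_inj; apply/funext. Qed.

Lemma der0 (K : fieldType) (A : comAlgType K) (D : Der A) : D 0 = 0.
Proof. by rewrite -[X in D X](scale0r 0) derZ scale0r. Qed.

Lemma der1 (K : fieldType) (A : comAlgType K) (D : Der A) : D 1 = 0.
Proof.
by apply: (addrI (D 1)); rewrite addr0 -{3}[1]mulr1 derM mulr1 mul1r.
Qed.

Lemma lbr_mul_der (K : fieldType) (A : comAlgType K) (a b : A) (D : Der A) :
  lbr (mul_der a D) (mul_der b D) = mul_der (a * D b - b * D a) D.
Proof.
apply: der_eqP => x; rewrite lbrDerE /= !derM.
rewrite !mulrDr mulrBl !mulrA (mulrC b a).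
by rewrite opprD addrACA subrr add0r.
Qed.

Section W1Basis.
Variable K : fieldType.
Implicit Type D : W1 K.

Lemma W1_eX (i : int) : W1_e K i 'X = 'X^(absz (i + 1)).
Proof. by rewrite /= derivX mulr1. Qed.

Lemma W1_derE D p : D p = D 'X * p^`().
Proof.
elim/poly_ind: p => [|p c IH].
  by rewrite der0 deriv0 mulr0.
rewrite derD derM IH -[c%:P]mulr1 mul_polyC derZ der1 scaler0 addr0.
rewrite derivD derivM derivX derivZ derivE scaler0 addr0 mulr1 mulrDr.
by rewrite (mulrC p) mulrA [RHS]addrC.
Qed.

Lemma W1_bracket (i j : int) : -1 <= i -> -1 <= j ->
  lbr (W1_e K i) (W1_e K j) = (j - i)%:~R *: W1_e K (i + j).
Proof.
move=> i_ge j_ge.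
have [m ->] : exists m : nat, i = m%:Z - 1 by exists (absz (i + 1)); lia.
have [n ->] : exists n : nat, j = n%:Z - 1 by exists (absz (j + 1)); lia.
have Xd (a b : nat) : ('X^a * ('X^b)^`() : {poly K})
    = b%:R *: 'X^(absz (a%:Z - 1 + (b%:Z - 1) + 1)).
  case: b => [|b]; first by rewrite expr0 derivC mulr0 scale0r.
  rewrite derivXn mulrnAr -exprD scaler_nat.
  by congr ('X^ _ *+ _); lia.
rewrite lbr_mul_der; apply: der_eqP => p; rewrite der_scaleE /=.
rewrite scalerAl !subrK; congr (_ * _).
rewrite !Xd (addrC (n%:Z - 1)) -scalerBl; congr (_ *: _).
by rewrite opprB addrA subrK intrB.
Qed.

Lemma W1_span D :
  D = \sum_(k < size (D 'X)) (D 'X)`_k *: W1_e K (k%:Z - 1).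
Proof.
apply: der_eqP => p; rewrite der_sumE W1_derE.
rewrite -{1}[D 'X]coefK poly_def mulr_suml; apply: eq_bigr => k _.
by rewrite /= subrK scalerAl.
Qed.

Lemma W1_free n (c : 'I_n -> K) :
  \sum_k c k *: W1_e K (k%:Z - 1) = 0 -> forall k, c k = 0.
Proof.
move=> /(congr1 (fun D : W1 K => (D 'X : {poly K}))) + k.
rewrite der_sumE => /(congr1 (fun p : {poly K} => p`_k)).
rewrite coef_sum (bigD1 k) //= big1 => [|i ik].
  by rewrite derivX mulr1 subrK coefZ coefXn eqxx mulr1 addr0 coef0.
rewrite derivX mulr1 subrK coefZ coefXn.
by rewrite -(inj_eq val_inj) eq_sym in ik; rewrite (negPf ik) mulr0.
Qed.

End W1Basis.

Section U1Basis.
Variable K : fieldType.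
Implicit Type D : U1 K.

Definition laurent_t : laurent K := << 1%R >>.

Lemma U1_eX (i : int) : U1_e K i laurent_t = << i + 1 >>.
Proof.
by rewrite /= laurent_derivU laurentM_UU mulr1 subrr addr0.
Qed.

Lemma U1_derE D f : D f = D laurent_t * laurent_ddt K f.
Proof.
pose E : U1 K := D - mul_der (D laurent_t) (laurent_ddt K).
have EE g : E g = D g - D laurent_t * laurent_ddt K g by [].
pose T (i : int) : laurent K := << i >>.
have tX (i j : int) : T (i + j) = T i * T j by rewrite /T laurentM_UU mulr1.
have Et : E (T 1) = 0.
  by rewrite EE /= laurent_derivU subrr mulr1 subrr.
have tV : T 1 * T (-1) = 1 by rewrite -tX.
have EtV : E (T (-1)) = 0.
  have := der1 E; rewrite -tV derM Et mul0r addr0 => /(congr1 ( *%R (T (-1)))).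
  by rewrite mulr0 mulrA (mulrC (T (-1))) tV mul1r.
have Epos (n : nat) : E (T n%:Z) = 0.
  elim: n => [|n IH]; first exact: der1.
  by rewrite intS tX derM IH Et mulr0 mul0r addr0.
have Eneg (n : nat) : E (T (- n%:Z)) = 0.
  elim: n => [|n IH]; first exact: der1.
  by rewrite intS opprD tX derM IH EtV mulr0 mul0r addr0.
have E0 (i : int) : E (T i) = 0.
  by case: (intP i) => [|n|n]; [exact: (Epos 0) | exact: Epos | exact: Eneg].
apply/eqP; rewrite -subr_eq0 -EE; apply/eqP.
elim/laurent_ind: f => [|f g Ef Eg|c i].
- exact: der0.
- by rewrite derD Ef Eg addr0.
by rewrite -[c]mulr1 -laurent_scaleU derZ E0 scaler0.
Qed.

Lemma U1_bracket (i j : int) :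
  lbr (U1_e K i) (U1_e K j) = (j - i)%:~R *: U1_e K (i + j).
Proof.
rewrite lbr_mul_der; apply: der_eqP => f; rewrite der_scaleE /=.
rewrite scalerAl; congr (_ * _).
rewrite !laurent_derivU !laurentM_UU laurent_scaleU !mul1r mulr1.
rewrite !addrK (addrAC i) (addrC (j + 1)) addrA -monalgUB.
by rewrite -mulrzBr opprD addrACA subrr addr0.
Qed.

Lemma U1_span D :
  D = \sum_(k <- msupp (D laurent_t : laurent K))
        (D laurent_t : laurent K)@_k *: U1_e K (k - 1).
Proof.
apply: der_eqP => f; rewrite der_sumE U1_derE.
rewrite {1}[D laurent_t]monalgE mulr_suml; apply: eq_bigr => k _.
by rewrite /= subrK scalerAl laurent_scaleU mulr1.
Qed.

Lemma U1_free (s : {fset int}) (c : int -> K) :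
  \sum_(i <- s) c i *: U1_e K i = 0 -> forall i, i \in s -> c i = 0.
Proof.
move=> /(congr1 (fun D : U1 K => (D laurent_t : laurent K))) + i si.
rewrite der_sumE => /(congr1 (fun f : laurent K => f@_(i + 1))).
rewrite mcoeff0 raddf_sum /= (big_fsetD1 i) //= big1_fset => [|k].
  by rewrite laurent_derivU laurentM_UU laurent_scaleU subrr !addr0
    mcoeffUU !mulr1.
rewrite in_fsetD1 => /andP[ki _] _.
rewrite laurent_derivU laurentM_UU laurent_scaleU mcoeffU subrr addr0.
by rewrite (inj_eq (addIr 1)) (negPf ki).
Qed.

End U1Basis.

Section Substitution.
Variables (K : fieldType) (A : comAlgType K) (l : var -> Der A).

Definition word_act (w : {fmonom var}) (a : A) : A :=
  foldr (fun x b => l x b) a w.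

Definition assoc_act (f : free_assoc K) (a : A) : A :=
  \sum_(w <- msupp f) f@_w *: word_act w a.

Lemma assoc_actw (d : {fset {fmonom var}}) f a : (msupp f `<=` d)%fset ->
  assoc_act f a = \sum_(w <- d) f@_w *: word_act w a.
Proof.
move=> le_fd; rewrite /assoc_act; apply: big_fset_incl => //.
by move=> w _ /mcoeff_outdom ->; rewrite scale0r.
Qed.

Lemma assoc_actP c f g a :
  assoc_act (c *: f + g) a = c *: assoc_act f a + assoc_act g a.
Proof.
pose d := (msupp f `|` msupp g)%fset.
rewrite !(@assoc_actw d) ?fsubsetUl ?fsubsetUr //.
  rewrite scaler_sumr -big_split; apply: eq_bigr => w _ /=.
  by rewrite mcoeffD mcoeffZ scalerDl scalerA.
apply: fsubset_trans (msuppD_le _ _) _.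
by apply: fsetSU; exact: msuppZ_le.
Qed.

Lemma assoc_act0 a : assoc_act 0 a = 0.
Proof. by rewrite /assoc_act msupp0 big_seq_fset0. Qed.

Lemma assoc_actD f g a : assoc_act (f + g) a = assoc_act f a + assoc_act g a.
Proof. by rewrite -[f in LHS]scale1r assoc_actP scale1r. Qed.

Lemma assoc_actB f g a : assoc_act (f - g) a = assoc_act f a - assoc_act g a.
Proof. by rewrite addrC -scaleN1r assoc_actP scaleN1r addrC. Qed.

Lemma assoc_actU c w a : assoc_act << c *g w >> a = c *: word_act w a.
Proof. by rewrite (assoc_actw _ msuppU_le) big_seq_fset1 mcoeffUU. Qed.

Lemma word_act_linear w : linear (word_act w).
Proof.
case: w => s c a b; rewrite /word_act /=.
by elim: s => //= x s ->; exact: der_linear.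
Qed.

Lemma word_actZ w c a : word_act w (c *: a) = c *: word_act w a.
Proof. by case: w => s; rewrite /word_act /=; elim: s => //= x s ->; rewrite derZ. Qed.

Lemma assoc_act_linear f : linear (assoc_act f).
Proof.
move=> c a b; rewrite /assoc_act scaler_sumr -big_split; apply: eq_bigr => w _.
by rewrite /= word_act_linear scalerDr !scalerA mulrC.
Qed.

Lemma assoc_actDr f a b : assoc_act f (a + b) = assoc_act f a + assoc_act f b.
Proof. by rewrite -[a in LHS]scale1r assoc_act_linear scale1r. Qed.

Lemma assoc_act0r f : assoc_act f 0 = 0.
Proof. by apply: (addrI (assoc_act f 0)); rewrite -assoc_actDr !addr0. Qed.

Lemma free_assoc_ind (P : free_assoc K -> Prop) :
  P 0 -> (forall f g, P f -> P g -> P (f + g)) ->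
  (forall c w, P << c *g w >>) -> forall f, P f.
Proof.
move=> P0 PD PU f; rewrite [f]monalgE.
by elim/big_ind: _ => // w _; exact: PU.
Qed.

Lemma assoc_actM f g a : assoc_act (f * g) a = assoc_act f (assoc_act g a).
Proof.
elim/free_assoc_ind: f => [|f f' IH IH'|c w].
- by rewrite mul0r !assoc_act0.
- rewrite (mulrDl f f' g) (assoc_actD (f * g)) (assoc_actD f).
  exact: (congr2 _ IH IH').
elim/free_assoc_ind: g => [|g g' IH IH'|c' w'].
- by rewrite mulr0 !assoc_act0 assoc_act0r.
- rewrite (mulrDr _ g g') (assoc_actD (_ * g)) (assoc_actD g)
    (assoc_actDr << c *g w >>).
  exact: (congr2 _ IH IH').
rewrite malgM_def fgmulUU !assoc_actU /word_act fmM foldr_cat -/(word_act w' a).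
rewrite -/(word_act w _) -/(word_act w _).
by rewrite word_actZ scalerA.
Qed.

Lemma free_lie_act_der f : free_lie_set f -> assoc_act f \in @der_pred K A.
Proof.
apply: (smallest_sub (X := [set f | assoc_act f \in @der_pred K A])) => /=.
  split; first split=> [|c u v uD vD]; rewrite /mkset.
  - rewrite (_ : assoc_act 0 = 0) ?rpred0 //.
    by apply/funext => a; rewrite assoc_act0.
  - rewrite (_ : assoc_act _ = c *: assoc_act u + assoc_act v).
      by rewrite rpredD ?rpredZ.
    by apply/funext => a; rewrite assoc_actP.
  move=> u v uD vD; rewrite /mkset.
  rewrite (_ : assoc_act _ = val (lbr (MkDer uD) (MkDer vD))) ?der_funP //.
  apply/funext => a; rewrite /commutator (assoc_actB (_ * _)).
  exact: (congr2 _ (assoc_actM u v a) (congr1 -%R (assoc_actM v u a))).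
move=> _ [x _ <-] /=; rewrite (_ : assoc_act _ = l x) ?der_funP //.
by apply/funext => a; rewrite assoc_actU scale1r /word_act fmU.
Qed.

Lemma free_lie_ext : exists2 phi : free_lie K -> Der A,
  lie_hom phi & forall x, phi (free_lie_gen K x) = l x.
Proof.
have fP (f : free_lie K) : assoc_act (val f) \in @der_pred K A.
  exact/free_lie_act_der/asboolP/free_lie_valP.
exists (fun f => MkDer (fP f)).
  split=> [c f g|f g]; apply: val_inj; apply/funext => a /=.
    by rewrite assoc_actP.
  rewrite /commutator (assoc_actB (_ * _)).
  exact: (congr2 _ (assoc_actM _ _ a) (congr1 -%R (assoc_actM _ _ a))).
move=> x; apply: val_inj; apply/funext => a /=.
by rewrite assoc_actU scale1r /word_act fmU.
Qed.

End Substitution.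

Lemma free_lie_hom_ext (K : fieldType) (L : lieAlgType K)
    (phi psi : free_lie K -> L) : lie_hom phi -> lie_hom psi ->
  (forall x, phi (free_lie_gen K x) = psi (free_lie_gen K x)) -> phi =1 psi.
Proof.
move=> [lphi bphi] [lpsi bpsi] eq_gen f.
have hom0 (h : free_lie K -> L) : linear h -> h 0 = 0.
  by move=> lh; apply: (addrI (h 0)); rewrite addr0 -{1}[h 0]scale1r -lh
    scale1r addr0.
pose S := [set u | exists2 g : free_lie K, val g = u & phi g = psi g].
suff /(_ (val f)) : @free_lie_set K `<=` S.
  by case=> [|g /val_inj <- //]; exact/asboolP/free_lie_valP.
apply: smallest_sub => [|_ [x _ <-]]; last by exists (free_lie_gen K x).
split; first split.
- by exists 0; rewrite ?raddf0 ?hom0.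
- move=> c _ _ [u <- eu] [v <- ev]; exists (c *: u + v); first exact: linearP.
  by rewrite lphi lpsi eu ev.
move=> _ _ [u <- eu] [v <- ev]; exists (lbr u v) => //.
by rewrite bphi bpsi eu ev.
Qed.

(* The value $f(l_1, \dots, l_n)$ is the image of [f] under the homomorphism
   which sends the variables to the $l_i$; such a homomorphism is determined by
   the $l_i$ ([free_lie_hom_ext]), and exists ([free_lie_ext]). *)
Definition graded_identities (K : fieldType) (L : lieAlgType K)
    (comp : int -> set L) : set (free_lie K) :=
  [set f | forall phi : free_lie K -> L, lie_hom phi ->
     (forall x, comp (var_deg x) (phi (free_lie_gen K x))) -> phi f = 0].

Definition graded_endo (K : fieldType) (phi : free_lie K -> free_lie K) : Prop :=
  lie_hom phi /\
  forall i f, @free_lie_comp K i f -> @free_lie_comp K i (phi f).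

Definition T_ideal (K : fieldType) (I : set (free_lie K)) : Prop :=
  lie_ideal I /\ forall phi, graded_endo phi -> forall f, I f -> I (phi f).

Definition is_basis (K : fieldType) (S I : set (free_lie K)) : Prop :=
  smallest (@T_ideal K) S = I.

Definition finitely_based (K : fieldType) (I : set (free_lie K)) : Prop :=
  exists2 S : set (free_lie K), finite_set S & is_basis S I.

(* Main.v *)
Require Import Defs.
From mathcomp Require Import all_boot all_order all_algebra finmap.
From mathcomp Require Import boolp classical_sets cardinality.
From mathcomp Require Import zify.
From mathcomp Require Import monalg.

(** In both algebras every component is at most one-dimensional, so
    [x_1^a, x_2^a] is a graded identity for every degree [a].  No finite set [S]
    can imply all of these.  Choose [a > 0] larger than the degrees of all
    variables occurring in [S], and let [J] be the set of polynomials killed by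
    every Lie homomorphism, into a fixed nonabelian Lie algebra, that vanishes
    on the variables of degree less than [a].  Then [J] contains [S], because
    such a homomorphism kills every variable of [S].  It does not contain
    [x_1^a, x_2^a], because the variables of degree [a] may be sent anywhere.

    The point is that [J] is a T-ideal: a graded endomorphism sends a variable
    of degree less than [a] to a polynomial of the same degree, and since [a] is
    positive, a nonempty word in letters of degree at least [a] has degree at
    least [a].  So each nonempty word of the image contains a letter of degree
    less than [a] and is killed, and the empty word contributes nothing to a
    Lie polynomial ([lie_hom_eq0], [low_comp_eq0], [low_ideal_T_ideal]).

    The target Lie algebra is [Der {poly K}]; with derivations as values, a
    homomorphism is computed word by word, as a composition of derivations
    ([lie_hom_assoc_act]). *)

Set Implicit Arguments.
Unset Strict Implicit.
Unset Printing Implicit Defensive.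

Import Order.TTheory GRing.Theory Num.Theory.

Local Open Scope ring_scope.
Local Open Scope classical_set_scope.

Lemma lie_hom0 (K : fieldType) (L M : lieAlgType K) (psi : L -> M) :
  lie_hom psi -> psi 0 = 0.
Proof.
by move=> [lpsi _]; rewrite -[X in psi X](addNr 0) -scaleN1r lpsi scaleN1r addNr.
Qed.

Section HomsToDerivations.
Variables (K : fieldType) (A : comAlgType K).
Implicit Types (psi : free_lie K -> Der A) (f : free_lie K).

(** Since [psi] takes values in endomorphisms of [A], it extends to the free
    associative algebra, where vanishing can be tested on each word. *)
Lemma lie_hom_assoc_act psi f a : lie_hom psi ->
  psi f a = assoc_act (fun x => psi (free_lie_gen K x)) (val f) a.
Proof.
move=> hpsi; have [lpsi bpsi] := hpsi; set l := fun x => _.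
pose S := [set u : free_assoc K | exists2 g : free_lie K,
  val g = u & forall b, psi g b = assoc_act l u b].
suff /(_ (val f)) : @free_lie_set K `<=` S.
  by case=> [|g /val_inj <- //]; exact/asboolP/free_lie_valP.
apply: smallest_sub => [|_ [x _ <-]]; last first.
  exists (free_lie_gen K x) => // b.
  by rewrite assoc_actU scale1r /word_act fmU.
split; first split.
- exists 0 => [|b]; first exact: raddf0.
  by rewrite assoc_act0 lie_hom0.
- move=> c _ _ [u <- eu] [v <- ev]; exists (c *: u + v); first exact: linearP.
  by move=> b; rewrite assoc_actP -eu -ev lpsi.
move=> _ _ [u <- eu] [v <- ev]; exists (lbr u v) => // b.
rewrite bpsi lbrDerE /commutator (assoc_actB _ (_ * _)) eu ev.
by rewrite (assoc_actM _ (val u)) (assoc_actM _ (val v)) ev eu.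
Qed.

Lemma word_act_eq0 (l : var -> Der A) (w : {fmonom var}) x b :
  x \in (w : seq var) -> l x = 0 -> word_act l w b = 0.
Proof.
case: w => s /= + lx; rewrite /word_act /=; elim: s => //= y s IH.
rewrite in_cons => /orP[/eqP <-|/IH ->]; first by rewrite lx.
exact: der0.
Qed.

(** The nonempty words act as zero, so [psi f] is multiplication by the constant
    term of [f]; being a derivation, it kills [1], so it is zero. *)
Lemma lie_hom_eq0 psi f : lie_hom psi ->
  (forall w, w \in msupp (val f) -> (w : seq var) != [::] ->
     exists2 x, x \in (w : seq var) & psi (free_lie_gen K x) = 0) ->
  psi f = 0.
Proof.
move=> hpsi kill; apply: der_eqP => a.
suff E b : psi f b = (val f)@_(fmone var) *: b.
  by have := der1 (psi f); rewrite E -[a]mul1r E scalerAl => ->; rewrite mul0r.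
have le1 := fsubsetUl (msupp (val f)) [fset fmone var]%fset.
rewrite (lie_hom_assoc_act f b hpsi) (assoc_actw _ _ le1).
rewrite (big_fsetD1 (fmone var)) /=; last by rewrite !inE eqxx orbT.
rewrite big1_fset ?addr0 => [|w].
  by rewrite /word_act fm1.
rewrite !inE => /andP[w1]; rewrite (negPf w1) orbF => wf _.
have [|x xw x0] := kill w wf; last by rewrite (word_act_eq0 b xw) ?scaler0.
by apply: contra w1 => /eqP w0; apply/eqP/val_inj; rewrite /= w0 fm1.
Qed.

End HomsToDerivations.

Section LowIdeal.
Variables (K : fieldType) (A : comAlgType K) (a : int).
Hypothesis a_gt0 : 0 < a.

Definition kills_low (psi : free_lie K -> Der A) : Prop :=
  forall x, var_deg x < a -> psi (free_lie_gen K x) = 0.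

Definition low_ideal : set (free_lie K) :=
  [set f | forall psi, lie_hom psi -> kills_low psi -> psi f = 0].

Lemma word_deg_low (w : {fmonom var}) : (w : seq var) != [::] ->
  word_deg w < a -> exists2 x, x \in (w : seq var) & var_deg x < a.
Proof.
move=> w0 wa; have [/hasP[x xw xa]|/hasPn high] :=
  boolP (has (fun x => var_deg x < a) (w : seq var)); first by exists x.
suff : a <= word_deg w by rewrite leNgt wa.
rewrite /word_deg; case: (w : seq var) w0 high => // x s _ high.
rewrite big_cons -[leLHS]addr0 lerD //.
  by rewrite leNgt high ?mem_head.
rewrite big_seq; apply: sumr_ge0 => y ys; apply: (le_trans (ltW a_gt0)).
by rewrite leNgt high // in_cons ys orbT.
Qed.

(** This is what makes [low_ideal] stable under graded endomorphisms: composing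
    one with a [psi] killing the low variables gives a map that kills them
    again. *)
Lemma low_comp_eq0 (psi : free_lie K -> Der A) i (f : free_lie K) :
  lie_hom psi -> kills_low psi -> i < a -> @free_lie_comp K i f -> psi f = 0.
Proof.
move=> hpsi low ia fi; apply: lie_hom_eq0 => // w /fi wi w0.
have [|x xw xa] := word_deg_low w0; first by rewrite wi.
by exists x => //; exact: low.
Qed.

Lemma free_lie_gen_comp x : @free_lie_comp K (var_deg x) (free_lie_gen K x).
Proof.
move=> w /=; rewrite msuppU oner_eq0 inE => /eqP ->.
by rewrite /word_deg fmU big_seq1.
Qed.

Lemma low_ideal_T_ideal : T_ideal low_ideal.
Proof.
split=> [|phi [[lphi bphi] gphi] f If psi [lpsi bpsi] low].
  split=> [|u v Iv psi hpsi low]; last first.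
    rewrite (proj2 hpsi) (Iv psi) //; apply: der_eqP => b.
    by rewrite lbrDerE (der0 (psi u)) subrr.
  split=> [psi hpsi _|c u v Iu Iv psi hpsi low]; first exact: lie_hom0.
  by rewrite (proj1 hpsi) (Iu psi) // (Iv psi) // scaler0 addr0.
apply: (If (psi \o phi)) => [|x xa /=].
  by split=> [c u v|u v] /=; rewrite ?lphi ?lpsi ?bphi ?bpsi.
by apply: (low_comp_eq0 _ _ xa (gphi _ _ (@free_lie_gen_comp x))).
Qed.

End LowIdeal.

Lemma finite_var_deg_bound (K : fieldType) (S : set (free_lie K)) :
  finite_set S -> exists2 a : int, 0 < a &
    forall (f : free_lie K) w x, S f -> w \in msupp (val f) -> x \in (w : seq var) ->
      var_deg x < a.
Proof.
move=> /finite_seqP[s ->].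
pose letters := flatten [seq flatten [seq (w : seq var) | w : {fmonom var} <- msupp (val f)]
  | f : free_lie K <- s].
exists (\max_(x <- letters) absz (var_deg x)).+1%:Z => // f w x /= fs wf xw.
have xl : x \in letters.
  by apply/flatten_mapP; exists f => //; apply/flatten_mapP; exists w.
have := @leq_bigmax_seq _ letters xpredT (fun x => absz (var_deg x)) x xl isT.
by set m := (\max_(_ <- _) _)%N; move: (var_deg x) => d /=; lia.
Qed.

Definition deg_comm (K : fieldType) (a : int) : free_lie K :=
  lbr (free_lie_gen K (a, 0%N)) (free_lie_gen K (a, 1%N)).

(** The two variables can be sent to noncommuting derivations, here [t d/dt] and
    [t^2 d/dt], and all other variables to zero. *)
Lemma deg_comm_notin_low (K : fieldType) (a : int) :
  ~ low_ideal {poly K} a (deg_comm K a).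
Proof.
pose l (x : var) : W1 K :=
  if x == (a, 0%N) then W1_e K 0 else if x == (a, 1%N) then W1_e K 1 else 0.
have [psi hpsi psiE] := free_lie_ext l.
move=> /(_ psi hpsi); rewrite (proj2 hpsi) !psiE /l !xpair_eqE eqxx /=.
rewrite W1_bracket // subr0 scale1r add0r => e1_eq0.
have /e1_eq0 /(congr1 (fun D : W1 K => D 'X)) : kills_low a psi.
  move=> [i n]; rewrite psiE /l /var_deg !xpair_eqE /= => ia.
  by rewrite (lt_eqF ia).
rewrite W1_eX => /eqP; apply/negP.
by rewrite -size_poly_eq0 size_polyXn.
Qed.

(** A finite [S] involves only variables of degree below some [a > 0], so every
    homomorphism killing those variables kills [S]; hence the T-ideal of [S] lies
    in [low_ideal a], which misses [deg_comm K a]. *)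
Lemma not_finitely_based_of_deg_comm (K : fieldType) (I : set (free_lie K)) :
  (forall a, I (deg_comm K a)) -> ~ finitely_based I.
Proof.
move=> Icomm [S finS basisS]; have [a a_gt0 bound] := finite_var_deg_bound finS.
apply: (@deg_comm_notin_low K a).
have : smallest (@T_ideal K) S (deg_comm K a) by rewrite basisS.
apply; split=> [|f Sf psi hpsi low]; first exact: low_ideal_T_ideal.
apply: lie_hom_eq0 => // w wf w0.
case E: (w : seq var) w0 => [|x s] // _; exists x; first exact: mem_head.
by apply: low; apply: (bound f w) => //; rewrite E mem_head.
Qed.

Lemma deg_comm_identity (K : fieldType) (A : comAlgType K)
    (comp : int -> set (Der A)) (e : int -> Der A) (a : int) :
  comp a `<=` range (fun c : K => c *: e a) ->
  graded_identities comp (deg_comm K a).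
Proof.
move=> line phi [_ bphi] gphi; rewrite bphi.
have [c _ <-] := line _ (gphi (a, 0%N)).
have [d _ <-] := line _ (gphi (a, 1%N)).
apply: der_eqP => b; rewrite lbrDerE !der_scaleE !derZ !scalerA mulrC.
exact: subrr.
Qed.

Theorem corollary4p7 (K : fieldType) (charK : 2%N \in [pchar K]) :
  ~ finitely_based (graded_identities (@U1_comp K)) /\
  ~ finitely_based (graded_identities (@W1_comp K)).
Proof.
split; apply: not_finitely_based_of_deg_comm => a.
  exact: (@deg_comm_identity _ _ _ (@U1_e K)).
apply: (@deg_comm_identity _ _ _ (@W1_e K)); rewrite /W1_comp.
by case: ifP => _ D //= ->; exists 0; rewrite ?scale0r.
Qed.
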